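(* For $1\le k\le n$, let $c_n(k)$ denote the number of 0/1-polytopes $P\subset\mathbb{R}^n$ with exactly $2^k$ vertices such that $(V(P),\oplus)$ is a subgroup of $(\{0,1\}^n,\oplus)$ and $P$ has dimension $n$; put $c_n(0)=0$. Then for all integers $k\ge 1$ and $n$ with $k\le n<2^k$ one has $$c_{n+1}(k)=c_n(k-1)+c_n(k)\,(2^k-n-1).$$
   Context: For a convex polytope $P$, $V(P)$ denotes its vertex set. A 0/1-polytope in $\mathbb{R}^n$ is a polytope $P\subset\mathbb{R}^n$ with $V(P)\subseteq\{0,1\}^n$. The symbol $\oplus$ denotes componentwise addition modulo 2 on $\{0,1\}^n$. Polytopes are counted as subsets of $\mathbb{R}^n$ (not up to equivalence). *)

(* Defs.v *)
From HB Require Import structures.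
From mathcomp Require Import all_boot all_order all_algebra all_fingroup.
From mathcomp Require Import finmap.
From mathcomp Require Import boolp classical_sets functions cardinality reals.
From mathcomp Require Import convex.

Set Implicit Arguments.
Unset Strict Implicit.
Unset Printing Implicit Defensive.

Import Order.TTheory GRing.Theory Num.Theory.

Local Open Scope classical_set_scope.
Local Open Scope ring_scope.

Definition convex_hull (R : realType) (n : nat) (A : set 'rV[R]_n) :
    set 'rV[R]_n :=
  smallest (@convex_set R 'rV[R]_n) A.

Definition polytope (R : realType) (n : nat) (P : set 'rV[R]_n) : Prop :=
  exists2 S : set 'rV[R]_n, finite_set S & P = convex_hull S.

(* Vertices are extreme points. *)
Definition vertices (R : realType) (n : nat) (P : set 'rV[R]_n) :
    set 'rV[R]_n :=
  [set x | P x /\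
    forall (y z : 'rV[R]_n) (t : R), P y -> P z -> 0 < t < 1 ->
      x = t *: y + (1 - t) *: z -> y = x /\ z = x].

Definition affine_subspace (R : realType) (n d : nat) (A : set 'rV[R]_n) :
    Prop :=
  exists (x : 'rV[R]_n) (U : {vspace 'rV[R]_n}),
    \dim U = d /\ A = [set x + u | u in [set` U]].

Definition affine_hull (R : realType) (n : nat) (A : set 'rV[R]_n) :
    set 'rV[R]_n :=
  smallest (fun B => exists d, affine_subspace d B) A.

(* Meaningful for nonempty P only; the empty set never occurs below. *)
Definition has_dim (R : realType) (n : nat) (P : set 'rV[R]_n) (d : nat) :
    Prop :=
  affine_subspace d (affine_hull P).

Definition zero_one_polytope (R : realType) (n : nat) (P : set 'rV[R]_n) :
    Prop :=
  polytope P /\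
  vertices P `<=` [set x | forall i, x ord0 i = 0 \/ x ord0 i = 1].

(* The group ({0,1}^n, (+)) is the additive group 'rV['F_2]_n; this map
   identifies its elements with the 0/1-points of R^n. *)
Definition real_of_bits (R : realType) (n : nat) (v : 'rV['F_2]_n) :
    'rV[R]_n :=
  \row_i (nat_of_ord (v ord0 i))%:R.

Definition xor_subgroup (R : realType) (n : nat) (V : set 'rV[R]_n) : Prop :=
  exists G : {group 'rV['F_2]_n}, V = @real_of_bits R n @` [set` G].

Definition counted_polytopes (R : realType) (n k : nat) :
    set (set 'rV[R]_n) :=
  [set P | zero_one_polytope P /\ (vertices P #= `I_(2 ^ k))%card /\
           xor_subgroup (vertices P) /\ has_dim P n].

(* [fset_set] enumerates a finite set and is empty on infinite ones; the set
   here is finite, since a polytope is the convex hull of its vertices. *)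
Definition c (R : realType) (n k : nat) : nat :=
  if k == 0%N then 0%N else #|` fset_set (@counted_polytopes R n k)|.

(* Main.v *)
Require Import Defs.
From mathcomp Require Import all_boot all_order all_algebra all_fingroup.
From mathcomp Require Import all_character.
From mathcomp Require Import boolp classical_sets functions cardinality reals.
From mathcomp Require Import interval_inference convex.
From mathcomp Require Import ring lra.

Set Implicit Arguments.
Unset Strict Implicit.
Unset Printing Implicit Defensive.

Import Order.TTheory GRing.Theory Num.Theory.
Local Open Scope ring_scope.

(** A counted polytope is the convex hull of a subgroup G of F_2^n of order
    2^k. In terms of the signs s_i(g) = (-1)^(g_i), which are characters of G,
    the i-th coordinate of a vertex is (1 - s_i) / 2; by orthogonality of
    characters, the vertices span R^n exactly when the s_i are nontrivial and
    pairwise distinct, that is, when the coordinate functionals of G over F_2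
    are nonzero and pairwise distinct. To count such G in F_2^(n+1), drop one
    coordinate to get H in F_2^n. If |H| = 2^(k-1), then G is the full preimage
    of H; if |H| = 2^k, then G is the graph of a functional on H which differs
    from 0 and from the n coordinate functionals, so there are 2^k - n - 1
    choices. *)

(** * Counting subgroups with distinct nonzero coordinates *)

Lemma F2_unit1 (a : {unit 'F_2}) : a = 1%g.
Proof.
by apply/val_inj; case: a => -[[|[|m]] lt_m] //= Ua; apply: val_inj.
Qed.

(** The only nonzero scalar of ['F_2] is 1, so every additive subgroup is already a linear subspace,
    and orders of groups can be read off from ranks. *)
Lemma rowg_mx_F2K n (G : {group 'rV['F_2]_n}) : rowg (rowg_mx G) = G.
Proof.
apply: stable_rowg_mxK; apply/fintype.subsetP=> a _; rewrite !inE /=.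
by apply/fintype.subsetP=> v Gv; rewrite inE /= (F2_unit1 a) scale_actE scale1r.
Qed.

Lemma card_group_F2 n (G : {group 'rV['F_2]_n}) :
  #|G| = (2 ^ \rank (rowg_mx G))%N.
Proof. by rewrite -{1}(rowg_mx_F2K G) card_rowg card_Fp. Qed.

Lemma group_F2_row_free n k (G : {group 'rV['F_2]_n}) : #|G| = (2 ^ k)%N ->
  exists2 M : 'M['F_2]_(k, n), row_free M & G = rowg M :> {set _}.
Proof.
rewrite card_group_F2 => /eqP; rewrite eqn_exp2l // => /eqP <-.
exists (row_base (rowg_mx G)); first exact: row_base_free.
by rewrite -{1}(rowg_mx_F2K G); apply/esym/eq_rowg/eq_row_base.
Qed.

(** Full-dimensionality of the polytope of [G], restated over ['F_2]; see [has_dim_separating]. *)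
Definition separating n (G : {set 'rV['F_2]_n}) : bool :=
  [forall i, [exists v in G, v 0 i != 0]] &&
  [forall i, forall j, (i != j) ==> [exists v in G, v 0 i != v 0 j]].

Lemma exists_rowg_functional m n (M : 'M['F_2]_(m, n)) (c : 'cV_n) :
  [exists v in rowg M, (v *m c) 0 0 != 0] = (M *m c != 0).
Proof.
apply/existsP/idP => [[v]|/cV0Pn[j nz]].
  case/andP; rewrite inE => /submxP[x ->]; apply: contraNneq => z.
  by rewrite -mulmxA z mulmx0 mxE.
by exists (row j M); rewrite inE row_sub -row_mul mxE.
Qed.

(** On [rowg M], the [j]-th coordinate functional is determined by its values on the rows, that is,
    by column [j]. The leading 0 in the list encodes that no coordinate vanishes. *)
Lemma separating_rowg m n (M : 'M['F_2]_(m, n)) :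
  separating (rowg M) = uniq (0 :: [seq col j M | j : 'I_n]).
Proof.
have colD i (v : 'rV['F_2]_n) : v 0 i = (v *m (delta_mx i 0 : 'cV_n)) 0 0.
  by rewrite -colE mxE.
rewrite /separating cons_uniq; congr (_ && _).
  apply/forallP/negP => [nz /mapP[i _ /esym Mi0]|nz i].
    have /existsP[v /andP[Mv]] := nz i; rewrite colD => vi.
    have := exists_rowg_functional M (delta_mx i 0).
    by rewrite -colE Mi0 eqxx => /existsP[]; exists v; apply/andP.
  under eq_existsb => v do rewrite colD.
  rewrite exists_rowg_functional -colE.
  by apply/eqP=> Mi0; apply: nz; apply/mapP; exists i; rewrite ?mem_enum.
have sep i j : [exists v in rowg M, v 0 i != v 0 j] = (col i M != col j M).
  rewrite -subr_eq0 !colE -mulmxBr -exists_rowg_functional.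
  by apply: eq_existsb => v; rewrite mulmxBr !mxE !colD subr_eq0 !mxE.
apply/forallP/injectiveP => [dist i j|inj i].
  by apply: contra_eq => ij; rewrite -sep; apply: (implyP (forallP (dist i) j)).
by apply/forallP => j; apply/implyP; rewrite sep; apply/contra_neq/inj.
Qed.

Definition tail_group n (G : {group 'rV['F_2]_(1 + n)}) : {group 'rV['F_2]_n} :=
  [group of rowg (rsubmx (rowg_mx G))].

(** Taking the right block is right multiplication by a fixed matrix, so it respects equality of row
    spaces and any generating matrix may be used. *)
Lemma tail_group_rowg m n (G : {group 'rV['F_2]_(1 + n)}) (A : 'M_(m, 1 + n)) :
  G = rowg A :> {set _} -> tail_group G = rowg (rsubmx A) :> {set _}.
Proof.
move=> defG; apply: eq_rowg.
have rsubE p (B : 'M['F_2]_(p, 1 + n)) : rsubmx B = B *m col_mx 0 1%:M.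
  by rewrite -{2}(hsubmxK B) mul_row_col mulmx0 mulmx1 add0r.
by rewrite !rsubE; apply: eqmxMr; rewrite defG; apply: rowgK.
Qed.

Lemma separating_row_mx m n (c : 'cV['F_2]_m) (M : 'M['F_2]_(m, n)) :
  separating (rowg (row_mx c M)) =
  (c \notin 0 :: [seq col j M | j : 'I_n]) && separating (rowg M).
Proof.
rewrite !separating_rowg /image_mem enum_ordSl map_cons -map_comp.
have -> : col ord0 (row_mx c M) = c.
  by apply/colP=> i; rewrite !mxE; case: splitP => // j _; rewrite (ord1 j).
have -> : [seq ((fun j => col j (row_mx c M)) \o lift ord0) j | j <- enum 'I_n]
          = [seq col j M | j <- enum 'I_n].
  apply: eq_map => j /=; apply/colP=> i; rewrite !mxE.
  case: splitP => [l|l /= /eqP]; first by rewrite (ord1 l).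
  by rewrite /bump /= eqn_add2l => /eqP /val_inj ->.
by rewrite !cons_uniq !inE !negb_or [0 == c]eq_sym andbACA.
Qed.

Lemma mxrank_row_mx_col (F : fieldType) m n (c : 'cV[F]_m) (M : 'M[F]_(m, n)) :
  (\rank M <= \rank (row_mx c M) <= (\rank M).+1)%N.
Proof.
rewrite -(mxrank_tr M) -(mxrank_tr (row_mx c M)) (tr_row_mx c M).
rewrite -(addsmxE c^T M^T) mxrankS ?addsmxSr //=.
apply: leq_trans (mxrank_adds_leqif _ _) _.
exact: (leq_add (rank_leq_row c^T) (leqnn _)).
Qed.

Definition separating_groups n (m : nat) : {set {group 'rV['F_2]_n}} :=
  [set G : {group 'rV['F_2]_n} | separating G & #|G| == m].

(** * Fibres of the map dropping the first coordinate *)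

Section Fibers.
Variables n k : nat.

(** Losing one column lowers the rank by at most one, and the remaining columns stay distinct and
    nonzero. *)
Lemma tail_separating (G : {group 'rV['F_2]_(1 + n)}) :
  G \in separating_groups (1 + n) (2 ^ k.+1) ->
  tail_group G
    \in separating_groups n (2 ^ k) :|: separating_groups n (2 ^ k.+1).
Proof.
rewrite !inE -(rowg_mx_F2K G) (tail_group_rowg (esym (rowg_mx_F2K G))).
set A := rowg_mx G; rewrite -{1 2}(hsubmxK A) separating_row_mx.
case/andP=> /andP[_ ->] /=; rewrite !card_rowg card_Fp //.
rewrite !eqn_exp2l // => /eqP rA.
have := mxrank_row_mx_col (lsubmx A) (rsubmx A); rewrite rA ltnS.
rewrite leq_eqVlt ltnS andb_orl => /orP[/andP[-> _]|rM]; first by rewrite orbT.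
by rewrite eqn_leq rM.
Qed.

(** A [G] of the same order as its projection [H] is the graph of a functional on [H]. Relative to a
    basis [M] of [H] this functional is a column [c], and separation asks exactly that [c] differ
    from 0 and from the columns of [M]. *)
Lemma card_fiber_graph (H : {group 'rV['F_2]_n}) :
  H \in separating_groups n (2 ^ k.+1) ->
  #|[set G in separating_groups (1 + n) (2 ^ k.+1) | tail_group G == H]|
    = (2 ^ k.+1 - n - 1)%N.
Proof.
rewrite inE => /andP[sepH /eqP oH].
have [M freeM defH] := group_F2_row_free oH.
move: sepH; rewrite defH separating_rowg => uniqM.
pose graph (c : 'cV['F_2]_k.+1) := [group of rowg (row_mx c M)].
have rank_graph (c : 'cV_k.+1) : \rank (row_mx c M) = k.+1.
  apply/eqP; rewrite eqn_leq rank_leq_row.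
  by have /andP[] := mxrank_row_mx_col c M; rewrite (eqP freeM).
have inj_graph : injective graph.
  move=> c d /(congr1 val) /= /setP cd; apply/row_matrixP=> i.
  (* Row [i] of [row_mx c M] is [x *m row_mx d M] for some [x]; freeness of [M] forces [x] to be the
     [i]-th unit vector, so [c] and [d] agree in row [i]. *)
  have := cd (row i (row_mx c M)); rewrite !inE row_sub => /esym/submxP[x].
  rewrite row_row_mx mul_mx_row => /eq_row_mx[-> iM].
  by rewrite -(row_free_inj freeM (etrans (esym (rowE i M)) iM)) -rowE.
pose S := [set c | c \notin 0 :: [seq col j M | j : 'I_n]].
have -> : [set G in separating_groups (1 + n) (2 ^ k.+1) | tail_group G == H]
          = graph @: S.
  apply/setP=> G; rewrite !inE; apply/idP/imsetP.
    case/andP=> /andP[sepG /eqP oG] /eqP tG.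
    have [A freeA defG] := group_F2_row_free oG.
    have sMA : (M <= rsubmx A)%MS.
      by rewrite -rowgS -(tail_group_rowg defG) tG defH.
    (* [B] writes the rows of [M] through the tails of the rows of [A]; applied to their heads it
       yields the column [c]. The resulting graph lies in [G], and comparing orders gives
       equality. *)
    have [B MB] := submxP sMA.
    have defG' : G = graph (B *m lsubmx A).
      apply/val_inj/eqP; rewrite eq_sym eqEcard /= defG rowgS.
      rewrite MB -mul_mx_row hsubmxK submxMl /=.
      have := rank_graph (B *m lsubmx A); rewrite MB -mul_mx_row hsubmxK => rBA.
      by rewrite !card_rowg !leq_exp2l ?card_Fp // rBA rank_leq_row.
    exists (B *m lsubmx A) => //; rewrite inE.
    by move: sepG; rewrite defG' separating_row_mx => /andP[].
  case=> c; rewrite inE => Sc ->.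
  rewrite separating_row_mx Sc separating_rowg uniqM /=.
  rewrite card_rowg card_Fp // rank_graph eqxx; apply/eqP/val_inj => /=.
  by rewrite (@tail_group_rowg _ _ (graph c) (row_mx c M)) // row_mxKr -defH.
(* The truncated subtraction is exact: by [uniqM], 0 and the [n] columns are [n.+1] distinct
   elements among [2 ^ k.+1]. *)
rewrite card_imset // -subnDA addn1.
have -> : S = ~: [set c in 0 :: [seq col j M | j : 'I_n]].
  by apply/setP=> c; rewrite !inE.
rewrite cardsCs finset.setCK card_mx muln1 card_Fp // cardsE.
by rewrite (card_uniqP uniqM) /= size_map size_enum_ord.
Qed.

(** Any such [G] lies in the full preimage of [H], whose order is also [2 ^ k.+1], so it equals that
    preimage. *)
Lemma card_fiber_preimage (H : {group 'rV['F_2]_n}) :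
  H \in separating_groups n (2 ^ k) ->
  #|[set G in separating_groups (1 + n) (2 ^ k.+1) | tail_group G == H]| = 1%N.
Proof.
rewrite inE => /andP[sepH /eqP oH].
have [M freeM defH] := group_F2_row_free oH.
(* The rows of [P] generate the preimage: the unit vector of the new coordinate, and a basis of [H]
   padded with 0. *)
pose P := block_mx (1%:M : 'M['F_2]_1) 0 0 M.
apply/eqP/cards1P; exists [group of rowg P]; apply/setP=> G; rewrite !inE.
have rP : \rank P = k.+1 by rewrite rank_diag_block_mx mxrank1 (eqP freeM).
have PE : P = row_mx (col_mx 1%:M 0) (col_mx 0 M) by rewrite /P block_mxEh.
have rowg0M : rowg (col_mx (0 : 'M_(1, n)) M) = rowg M.
  apply/eq_rowg; apply: eqmx_trans (eqmx_sym (addsmxE _ _)) _.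
  exact: adds0mx.
have tP : tail_group [group of rowg P] = H.
  apply/val_inj => /=; rewrite (@tail_group_rowg _ _ _ P) //.
  by rewrite PE row_mxKr rowg0M defH.
apply/idP/eqP => [|->]; last first.
  rewrite tP eqxx andbT card_rowg rP card_Fp // eqxx andbT.
  rewrite PE separating_row_mx rowg0M -defH sepH andbT inE negb_or.
  (* The new column has top entry 1, where 0 and the old columns have 0. *)
  have nz10 : (1%:M : 'M['F_2]_1) <> 0.
    by move/matrixP/(_ 0 0)/eqP; rewrite !mxE.
  apply/andP; split.
    by apply/eqP; rewrite -col_mx0 => /eq_col_mx[/nz10].
  by apply/mapP=> -[j _]; rewrite col_col_mx col0 => /eq_col_mx[/nz10].
case/andP=> /andP[sepG /eqP oG] /eqP tG; apply/val_inj/eqP.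
rewrite eqEcard /= oG card_rowg rP card_Fp // leqnn andbT.
apply/fintype.subsetP=> v Gv; rewrite inE.
have : (rsubmx v <= M)%MS.
  rewrite -mem_rowg -defH -tG (tail_group_rowg (esym (rowg_mx_F2K G))) mem_rowg.
  move: Gv; rewrite -{1}(rowg_mx_F2K G) mem_rowg => /submxP[x ->].
  by rewrite -[X in x *m X]hsubmxK mul_mx_row row_mxKr submxMl.
case/submxP=> x vx; apply/submxP; exists (row_mx (lsubmx v) x).
by rewrite mul_row_block !mulmx0 mulmx1 addr0 add0r -vx hsubmxK.
Qed.

End Fibers.

Theorem card_separating_groupsS n k :
  #|separating_groups n.+1 (2 ^ k.+1)| =
  (#|separating_groups n (2 ^ k)| +
   #|separating_groups n (2 ^ k.+1)| * (2 ^ k.+1 - n - 1))%N.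
Proof.
set S1 := separating_groups n (2 ^ k); set S2 := separating_groups n (2 ^ k.+1).
rewrite -[n.+1]add1n -sum1_card.
rewrite (partition_big (@tail_group n) (mem (S1 :|: S2))) /=; last first.
  exact: tail_separating.
have dis : [disjoint S1 & S2].
  apply/pred0P=> H /=; rewrite !inE; apply/negP.
  case/andP=> /andP[_ /eqP ->] /andP[_]; rewrite eqn_exp2l //.
  by rewrite ltn_eqF.
under eq_bigl => H do rewrite finset.in_setU.
rewrite bigU //=; congr (_ + _)%N.
  rewrite -sum1_card; apply: eq_bigr => H SH.
  by apply: etrans (card_fiber_preimage SH); rewrite -sum1dep_card.
rewrite -sum_nat_const; apply: eq_bigr => H SH.
by apply: etrans (card_fiber_graph SH); rewrite -sum1dep_card.
Qed.

(** * Convex hulls and vertices *)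

Local Open Scope classical_set_scope.

Section ConvexHull.
Variables (R : realType) (n : nat).
Implicit Types (A B : set 'rV[R]_n) (x y z s : 'rV[R]_n) (t : R).

Lemma convex_setP A : convex_set A <->
  forall x y t, A x -> A y -> 0 <= t <= 1 -> A (t *: x + (1 - t) *: y).
Proof.
split=> [cA x y t Ax Ay /andP[t0 t1]|cA x y t].
  by have := cA x y (Itv01 t0 t1); rewrite !inE; apply.
by rewrite !inE => Ax Ay; apply: (cA x y t%:num) => //; rewrite ge0 le1.
Qed.

Lemma convex_hull_convex A x y t : convex_hull A x -> convex_hull A y ->
  0 <= t <= 1 -> convex_hull A (t *: x + (1 - t) *: y).
Proof.
move=> Ax Ay t01 B [cB AB].
by move/convex_setP: (cB); apply=> //; [apply: Ax|apply: Ay].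
Qed.

Lemma convex_hull_min A B :
    (forall x y t, B x -> B y -> 0 <= t <= 1 -> B (t *: x + (1 - t) *: y)) ->
  A `<=` B -> convex_hull A `<=` B.
Proof. by move=> /convex_setP; apply: smallest_sub. Qed.

Lemma sub_convex_hull A : A `<=` convex_hull A.
Proof. exact: sub_gen_smallest. Qed.

Lemma convex_hullS A B : A `<=` B -> convex_hull A `<=` convex_hull B.
Proof.
move=> AB; apply: convex_hull_min; first exact: convex_hull_convex.
exact: subset_trans AB (sub_convex_hull (A := B)).
Qed.

(** If a vertex [x] were outside [A], the hull without [x] would still be convex, by extremality,
    and contain [A], against minimality. *)
Lemma vertices_convex_hull A : vertices (convex_hull A) `<=` A.
Proof.
move=> x [Ax ext_x]; apply: contrapT => nAx.
have : convex_hull A `<=` [set y | convex_hull A y /\ y <> x].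
  apply: convex_hull_min => [y z t [Ay yx] [Az zx] /andP[t0 t1]|y Ay].
    split; first by apply: convex_hull_convex => //; rewrite t0.
    move: t0 t1; rewrite !le_eqVlt.
    move=> /predU1P[<- _|t0 /predU1P[->|t1] /esym xE].
    - by rewrite scale0r subr0 scale1r add0r.
    - by move: xE; rewrite subrr scale0r scale1r addr0 => /esym.
    - by have [] := ext_x y z t Ay Az _ xE; rewrite ?t0 ?t1.
  split; first exact: sub_convex_hull.
  by move=> yx; apply: nAx; rewrite -yx.
by move=> /(_ x Ax)[].
Qed.

(* The cone over [convex_hull A] at height [b]; it makes convex combinations
   with a further point additive, without division. *)
Definition cone A (b : R) y :=
  0 <= b /\ exists2 u, b = 0 \/ convex_hull A u & y = b *: u.

Lemma coneD A b1 b2 y1 y2 : cone A b1 y1 -> cone A b2 y2 ->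
  cone A (b1 + b2) (y1 + y2).
Proof.
move=> [b1_ge0 [u1 h1 ->]] [b2_ge0 [u2 h2 ->]]; split; first exact: addr_ge0.
have [->|nz1] := eqVneq b1 0.
  by exists u2; rewrite ?add0r ?scale0r ?add0r.
have [->|nz2] := eqVneq b2 0.
  by exists u1; rewrite ?addr0 ?scale0r ?addr0.
have b1_gt0 : 0 < b1 by rewrite lt_def nz1.
have b2_gt0 : 0 < b2 by rewrite lt_def nz2.
have b_gt0 := addr_gt0 b1_gt0 b2_gt0; have nz := lt0r_neq0 b_gt0.
exists ((b1 / (b1 + b2)) *: u1 + (1 - b1 / (b1 + b2)) *: u2).
  case: h1 => [/eqP|h1]; first by rewrite (negPf nz1).
  case: h2 => [/eqP|h2]; first by rewrite (negPf nz2).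
  right; apply: convex_hull_convex => //.
  by rewrite ler_pdivrMr // mul1r lerDl b2_ge0 divr_ge0 // ltW.
by rewrite scalerDr !scalerA; congr (_ *: _ + _ *: _); field.
Qed.

Lemma coneZ A b y t : 0 <= t -> cone A b y -> cone A (t * b) (t *: y).
Proof.
move=> t0 [b0 [u hu ->]]; split; first exact: mulr_ge0.
exists u; rewrite ?scalerA //.
by case: hu => [->|]; [left; rewrite mulr0|right].
Qed.

(** The right-hand set contains [s] (weight 1) and [A] (weight 0). It is convex because cone parts
    add, their heights combining to one minus the combined weight of [s]. *)
Lemma convex_hullU1 A s : convex_hull (s |` A) `<=`
  [set x | exists a y, [/\ 0 <= a, cone A (1 - a) y & x = a *: s + y]].
Proof.
apply: convex_hull_min => [x1 x2 t|x [->|Ax]]; last 2 first.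
- exists 1, 0; split; rewrite ?scale1r ?addr0 // subrr; split=> //.
  by exists 0; [left|rewrite scaler0].
- exists 0, x; split; rewrite ?scale0r ?add0r // subr0; split => //.
  by exists x; rewrite ?scale1r //; right; apply: sub_convex_hull.
move=> [a1 [y1 [a1_ge0 C1 ->]]] [a2 [y2 [a2_ge0 C2 ->]]] /andP[t0 t1].
have t1' : 0 <= 1 - t by rewrite subr_ge0.
exists (t * a1 + (1 - t) * a2), (t *: y1 + (1 - t) *: y2); split.
- by rewrite addr_ge0 ?mulr_ge0.
- have -> : 1 - (t * a1 + (1 - t) * a2) = t * (1 - a1) + (1 - t) * (1 - a2).
    by ring.
  by apply: coneD; apply: coneZ.
- by rewrite !scalerDr !scalerA [X in _ = X + _]scalerDl addrACA.
Qed.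

(** Let [s], outside the hull of [A], be a proper convex combination of [y] and [z]. Cancelling the
    multiples of [s] puts [d *: s] in the cone at height [d]. If [d] is nonzero, dividing puts [s]
    in the hull; if [d] is 0, both [y] and [z] have full weight on [s]. *)
Lemma non_vertex_redundant A s :
  ~ vertices (convex_hull (s |` A)) s -> convex_hull A s.
Proof.
move=> nvs; apply: contrapT => nAs; apply: nvs; split.
  by apply: sub_convex_hull; left.
move=> y z t /convex_hullU1[a [y' [a0 Cy ->]]].
move=> /convex_hullU1[b [z' [b0 Cz ->]]].
case/andP=> t0 t1 sE; have t1' : 0 < 1 - t by rewrite subr_gt0.
have C := coneD (coneZ (ltW t0) Cy) (coneZ (ltW t1') Cz).
set d := t * _ + _ in C.
have dE : d *: s = t *: y' + (1 - t) *: z'.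
  have -> : d *: s = s - (t * a + (1 - t) * b) *: s.
    by rewrite -{2}[s]scale1r -scalerBl; congr (_ *: _); rewrite /d; ring.
  rewrite {1}sE !scalerDr !scalerA [X in _ - X]scalerDl addrACA.
  by rewrite [X in X - _]addrC addrK.
have [d0|nzd] := eqVneq d 0; last first.
  case: C => d_ge0 [u [/eqP|Au]]; first by rewrite (negPf nzd).
  by rewrite -dE => /(scalerI nzd) su; case: nAs; rewrite su.
case: Cy Cz => a1 [u _ y'E] [b1 [v _ z'E]].
have ta0 := mulr_ge0 (ltW t0) a1; have tb0 := mulr_ge0 (ltW t1') b1.
move/eqP: d0; rewrite /d paddr_eq0 // !mulf_eq0 (gt_eqF t0) (gt_eqF t1') /=.
case/andP=> /eqP a1E /eqP b1E.
rewrite y'E z'E a1E b1E !scale0r !addr0.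
have -> : a = 1 by apply/eqP; rewrite eq_sym -subr_eq0 a1E.
have -> : b = 1 by apply/eqP; rewrite eq_sym -subr_eq0 b1E.
by rewrite scale1r.
Qed.

(** Generators that are not vertices are discarded one at a time without changing the hull. Since
    [rem] drops one occurrence, the length decreases even when entries repeat. *)
Lemma convex_hull_vertices_seq (l : seq 'rV[R]_n) :
  convex_hull [set` l] `<=` convex_hull (vertices (convex_hull [set` l])).
Proof.
have [m] := ubnP (size l); elim: m l => // m IHm l le_lm.
have [all_v|] := pselect ([set` l] `<=` vertices (convex_hull [set` l])).
  exact: convex_hullS.
move=> /existsNP[s /not_implyP[/= ls nvs]].
have lE : [set` l] = s |` [set` rem s l].
  apply/seteqP; split=> x /=.
    by rewrite (perm_mem (perm_to_rem ls)) inE => /predU1P[->|]; [left|right].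
  by case=> [->//|]; apply: mem_rem.
have hullE : convex_hull [set` l] = convex_hull [set` rem s l].
  apply/seteqP; split; last by apply: convex_hullS => x /=; apply: mem_rem.
  apply: convex_hull_min; first exact: convex_hull_convex.
  rewrite lE => x [->|]; last exact: sub_convex_hull.
  by apply: non_vertex_redundant; rewrite -lE.
rewrite hullE; apply: IHm; rewrite size_rem //.
by case: (l) ls le_lm.
Qed.

Lemma polytope_hull_vertices (P : set 'rV[R]_n) :
  polytope P -> P = convex_hull (vertices P).
Proof.
move=> [S /finite_seqP[l ->] ->]; apply/seteqP; split.
  exact: convex_hull_vertices_seq.
by apply: convex_hullS; apply: vertices_convex_hull.
Qed.

Definition zero_one_points : set 'rV[R]_n :=
  [set x | forall i, x ord0 i = 0 \/ x ord0 i = 1].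

(** The hull lies in the unit cube, and in each coordinate 0 and 1 are endpoints of the interval, so
    a 0/1 point is extreme. *)
Lemma vertices_hull_zero_one A : A `<=` zero_one_points ->
  vertices (convex_hull A) = A.
Proof.
move=> A01; apply/seteqP; split; first exact: vertices_convex_hull.
have cube : convex_hull A `<=` [set x | forall i, 0 <= x ord0 i <= 1].
  apply: convex_hull_min => [x y t cx cy /andP[t0 t1] i|x /A01 x01 i].
    rewrite !mxE; have /andP[? ?] := cx i; have /andP[? ?] := cy i; nra.
  by case: (x01 i) => ->; rewrite ?lexx ?ler01.
move=> x Ax; split; first exact: sub_convex_hull.
move=> y z t /cube cy /cube cz /andP[t0 t1] /rowP xE.
suff yz i : y ord0 i = x ord0 i /\ z ord0 i = x ord0 i.
  by split; apply/rowP=> i; have [] := yz i.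
have := xE i; rewrite !mxE; have /andP[? ?] := cy i; have /andP[? ?] := cz i.
have [->|->] := A01 x Ax i => E; split; nra.
Qed.

End ConvexHull.

(** * Dimension and characters *)

Section Dimension.
Variables (R : realType) (n : nat).
Implicit Types (A : set 'rV[R]_n).

Lemma has_dim_setT A :
  (forall d B, affine_subspace d B -> A `<=` B -> B = setT) -> has_dim A n.
Proof.
move=> full; have -> : has_dim A n = affine_subspace n (setT : set 'rV[R]_n).
  congr affine_subspace; apply/seteqP; split => // x _ B [[d aB] AB].
  by rewrite (full d B).
exists 0, fullv; split; first by rewrite dimvf; apply: mul1n.
by apply/seteqP; split=> // x _; exists x; rewrite /= ?memvf ?add0r.
Qed.

(** The kernel of [c] is an affine subspace containing [A], so it contains the affine hull, here the
    whole space. *)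
Lemma has_dim_functional A (c : 'cV[R]_n) : has_dim A n ->
  (forall x, A x -> x *m c = 0) -> c = 0.
Proof.
move=> [x [U [dimU hullE]]] Ac.
have fullU : U = fullv.
  by apply/eqP; rewrite eqEdim subvf dimvf dimU; apply: eq_leq (mul1n n).
have affc : affine_hull A `<=` [set v | v *m c = 0].
  apply: smallest_sub => //.
  pose U0 := lker (linfun (mulmxr c : 'rV_n -> 'M_1)).
  exists (\dim U0), 0, U0; split=> //.
  apply/seteqP; split=> v /=.
    by move=> vc; exists v; rewrite ?add0r //= memv_ker lfunE /= vc.
  by case=> u; rewrite /= memv_ker lfunE /= => /eqP uc <-; rewrite add0r.
apply/colP=> i; rewrite mxE.
have : affine_hull A (delta_mx 0 i).
  rewrite hullE; exists (delta_mx 0 i - x); last by rewrite addrC subrK.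
  by rewrite /= fullU memvf.
by move/affc => /= /rowP/(_ 0); rewrite -rowE !mxE.
Qed.

End Dimension.

Section BitVectors.
Variables (R : realType) (n : nat).
Local Notation bits := (@real_of_bits R n).
Implicit Types (G : {group 'rV['F_2]_n}) (g h : 'rV['F_2]_n).

Lemma real_of_bits_inj : injective bits.
Proof.
move=> g h /rowP gh; apply/rowP=> i; apply/val_inj/eqP.
by have := gh i; rewrite !mxE => /eqP; rewrite eqr_nat.
Qed.

Lemma real_of_bits_zero_one A : bits @` A `<=` @zero_one_points R n.
Proof.
move=> _ [g _ <-] i; rewrite mxE.
by case: (g ord0 i) => -[|[|m]] //= _; [left|right].
Qed.

Definition bit_sign g i : R := (-1) ^+ (nat_of_ord (g ord0 i)).

Lemma bit_signD g h i : bit_sign (g + h) i = bit_sign g i * bit_sign h i.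
Proof.
rewrite /bit_sign mxE.
case: (g ord0 i) => -[|[|m]] //= p; case: (h ord0 i) => -[|[|m']] //= q.
all: by rewrite /= ?expr0 ?expr1 ?mulrNN ?mulr1 ?mul1r.
Qed.

Lemma bit_sign_sqr g i : bit_sign g i * bit_sign g i = 1.
Proof. by rewrite -expr2 sqrr_sign. Qed.

Lemma real_of_bitsE g i : bits g ord0 i = (1 - bit_sign g i) / 2.
Proof.
rewrite /bit_sign mxE; case: (g ord0 i) => -[|[|m]] //= _.
  by rewrite expr0 subrr mul0r.
by rewrite expr1; field.
Qed.

(** Translation by [h] permutes [G] and flips the sign of [F], so the sum is its own negative.
    Applied to signs and their products, this is character orthogonality. *)
Lemma sum_odd_eq0 G (F : 'rV['F_2]_n -> R) h : h \in G ->
  (forall g, F (g + h) = - F g) -> \sum_(g in G) F g = 0.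
Proof.
move=> Gh Fh; have : \sum_(g in G) F g = - \sum_(g in G) F g.
  rewrite -sumrN (reindex_inj (mulIg h)) /=.
  apply: eq_big => [g|g _]; [exact: groupMr|exact: Fh].
lra.
Qed.

(* The signs of the coordinates of [G] are distinct nontrivial characters; their
   orthogonality isolates a basis vector. *)
Lemma sum_sign_bits G j : separating G ->
  \sum_(g in G) bit_sign g j *: bits g = (- (#|G|%:R / 2)) *: delta_mx 0 j.
Proof.
case/andP=> /forallP nz /forallP dist; apply/rowP=> i.
have sum_sign l : \sum_(g in G) bit_sign g l = 0.
  have /existsP[h /andP[Gh hl]] := nz l; apply: (sum_odd_eq0 Gh) => g.
  rewrite bit_signD (_ : bit_sign h l = -1) ?mulrN1 // /bit_sign.
  by case: (h 0 l) hl => -[|[|m]] //=; rewrite expr1.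
rewrite summxE !mxE eqxx /=.
(* Each bit is [(1 - s_i) / 2] and [s_j] sums to 0, so entry [i] is minus half the sum of
   [s_j s_i]. *)
under eq_bigr => g _ do
  rewrite mxE real_of_bitsE mulrA mulrBr mulr1 mulrBl.
rewrite sumrB -!mulr_suml sum_sign mul0r sub0r mulNr; congr (- _).
rewrite mulrAC; congr (_ / 2).
have [->|ij] := eqVneq i j.
  by under eq_bigr => g _ do rewrite bit_sign_sqr; rewrite sumr_const mulr1.
rewrite mulr0.
have /implyP/(_ ij)/existsP[h /andP[Gh hij]] := forallP (dist i) j.
apply: (sum_odd_eq0 Gh) => g; rewrite !bit_signD mulrACA.
rewrite (_ : bit_sign h j * bit_sign h i = -1) ?mulrN1 // /bit_sign.
case: (h 0 i) (h 0 j) hij => -[|[|a]] //= p [[|[|b]]] //= q _.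
  by rewrite expr0 expr1 mulr1.
by rewrite expr0 expr1 mul1r.
Qed.

(** If a coordinate vanishes on [G], or two agree, then [e_i] or [e_i - e_j] is a nonzero functional
    killing the polytope. Conversely, an affine subspace containing the polytope contains the vertex
    0, so its direction [U] contains all vertices and, by [sum_sign_bits], every basis vector. *)
Lemma has_dim_separating G :
  has_dim (convex_hull (bits @` [set` G])) n <-> separating G.
Proof.
split=> [dimG|sepG].
  have hull0 (c : 'cV[R]_n) : (forall g, g \in G -> bits g *m c = 0) -> c = 0.
    move=> Gc; apply: (has_dim_functional dimG); apply: convex_hull_min.
      move=> x y t /= xc yc _.
      by rewrite mulmxDl -!scalemxAl xc yc !scaler0 addr0.
    by move=> _ [g /= Gg <-]; apply: Gc.
  apply/andP; split; apply/forallP=> i.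
    apply: contrapT => /negP; rewrite negb_exists_in => /forall_inP z.
    have /matrixP/(_ i 0)/eqP : (delta_mx i 0 : 'cV[R]_n) = 0.
      apply: hull0 => g Gg; rewrite -colE; apply/colP=> k.
      by move: (z g Gg); rewrite negbK !mxE => /eqP->.
    by rewrite !mxE !eqxx oner_eq0.
  apply/forallP=> j; apply/implyP=> ij.
  apply: contrapT => /negP; rewrite negb_exists_in => /forall_inP z.
  have /matrixP/(_ i 0)/eqP : (delta_mx i 0 - delta_mx j 0 : 'cV[R]_n) = 0.
    apply: hull0 => g Gg; rewrite mulmxBr -!colE; apply/colP=> k.
    by move: (z g Gg); rewrite negbK !mxE => /eqP->; rewrite subrr.
  by rewrite !mxE !eqxx (negPf ij) subr0 oner_eq0.
apply: has_dim_setT => d B [x [U [_ ->]]] GB.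
have Gx h : h \in G -> exists2 u, u \in U & x + u = bits h.
  move=> Gh; case: (GB (bits h)) => [|u Uu <-]; last by exists u.
  by apply: sub_convex_hull; exists h.
have GU g : g \in G -> bits g \in U.
  move=> /Gx[u Uu xu]; have [v Uv xv] := Gx 0 (group1 G).
  have bits0 : bits 0 = 0 by apply/rowP=> i; rewrite !mxE.
  by rewrite -[bits g]subr0 -xu -bits0 -xv opprD addrACA subrr add0r rpredB.
have fullU v : v \in U.
  rewrite [v]row_sum_delta; apply: rpred_sum => j _; apply: rpredZ.
  have nzG : - (#|G|%:R / 2) != 0 :> R.
    by rewrite oppr_eq0 mulf_neq0 ?invr_eq0 ?pnatr_eq0 // -lt0n cardG_gt0.
  rewrite -(scalerK nzG (delta_mx 0 j)); apply: rpredZ.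
  rewrite -sum_sign_bits //; apply: rpred_sum => g Gg.
  exact/rpredZ/GU.
apply/seteqP; split=> // y _; exists (y - x) => /=; first exact: fullU.
by rewrite addrC subrK.
Qed.

End BitVectors.

(** * From counted polytopes to separating subgroups *)

Section Counting.
Variables (R : realType) (n : nat).
Local Notation bits := (@real_of_bits R n).

Definition group_polytope (G : {group 'rV['F_2]_n}) : set 'rV[R]_n :=
  convex_hull (bits @` [set` G]).

Lemma vertices_group_polytope G :
  vertices (group_polytope G) = bits @` [set` G].
Proof. exact/vertices_hull_zero_one/real_of_bits_zero_one. Qed.

Lemma group_polytope_inj : injective group_polytope.
Proof.
move=> G H GH; apply/val_inj/setP=> g /=.
have := vertices_group_polytope G.
rewrite GH vertices_group_polytope => /seteqP[HG GH'].
apply/idP/idP=> Gg.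
  by have [|h Hh /real_of_bits_inj <-] := GH' (bits g); first by exists g.
by have [|h Hh /real_of_bits_inj <-] := HG (bits g); first by exists g.
Qed.

Lemma card_finset (T : finType) (A : {set T}) : ([set` A] #= `I_#|A|)%card.
Proof.
have -> : [set` A] = (@enum_val T (mem A)) @` [set: 'I_#|A|].
  apply/seteqP; split=> [x /= Ax|_ [i _ <-]]; last exact: enum_valP.
  by exists (enum_rank_in Ax x) => //; rewrite enum_rankK_in.
apply: card_eq_trans (inj_card_eq _) _; first by move=> i j _ _ /enum_val_inj.
by rewrite card_eq_sym; apply: card_II.
Qed.

Lemma counted_polytopesE k : @counted_polytopes R n k =
  group_polytope @` [set` separating_groups n (2 ^ k)].
Proof.
have cardV G : (vertices (group_polytope G) #= `I_#|G|)%card.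
  rewrite vertices_group_polytope.
  apply: card_eq_trans (inj_card_eq _) (card_finset _).
  by move=> g h _ _; apply: real_of_bits_inj.
apply/seteqP; split=> [P [[polyP _] [cardP [[G VE] dimP]]]|_ [G /= + <-]].
  have PE : P = group_polytope G by rewrite (polytope_hull_vertices polyP) VE.
  exists G => //=; rewrite inE; apply/andP; split.
    by apply/(has_dim_separating R); rewrite -/(group_polytope G) -PE.
  apply/eqP/card_eq_II; rewrite card_eq_sym in cardP.
  by rewrite card_eq_sym; apply: card_eq_trans cardP _; rewrite PE.
rewrite inE => /andP[sepG /eqP oG]; split; last split; last split.
- split; last by rewrite vertices_group_polytope; apply: real_of_bits_zero_one.
  by exists (bits @` [set` G]) => //; apply/finite_image/finite_finset.
- by rewrite -oG.
- by exists G; apply: vertices_group_polytope.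
- exact/has_dim_separating.
Qed.

(** The convention at [k = 0] agrees with the count: on the trivial group every coordinate vanishes,
    so with at least one coordinate it is not separating. *)
Lemma c_separating k : (0 < n)%N -> c R n k = #|separating_groups n (2 ^ k)|.
Proof.
rewrite /c => n_gt0; have [->|_] := eqVneq k 0%N.
  apply/esym/eqP; rewrite cards_eq0; apply/eqP/setP=> G; rewrite !inE expn0.
  apply/negP=> /andP[/andP[/forallP/(_ (Ordinal n_gt0)) nz0 _]].
  have /existsP[g /andP[Gg nz]] := nz0.
  rewrite -trivg_card1 => /eqP G1; move: Gg nz; rewrite G1 => /set1gP ->.
  by rewrite mxE eqxx.
apply: card_fset_set; rewrite counted_polytopesE.
apply: card_eq_trans (inj_card_eq _) (card_finset _).
by move=> G H _ _; apply: group_polytope_inj.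
Qed.

End Counting.

Theorem mainTheorem3 (R : realType) (n k : nat)
    (hk : (1 <= k)%N) (hkn : (k <= n)%N) (hn : (n < 2 ^ k)%N) :
  c R n.+1 k = (c R n (k - 1) + c R n k * (2 ^ k - n - 1))%N.
Proof.
have n_gt0 : (0 < n)%N := leq_trans hk hkn.
case: k hk {hkn hn} => // k _.
by rewrite !c_separating // subn1 card_separating_groupsS.
Qed.
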